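(* Let $\mathbb K$ be a commutative semiring, let $\mathcal C=\bigcup_{n,m\ge1}\mathcal C_{n,m}$ be a graded set of chips (each $\mathcal C_{n,m}$ finite), and let $\mu^0:\mathcal Circ(\mathcal C)\to\mathbb K(N_0)$ and $\mu^1:\mathcal Circ(\mathcal C)\to\mathbb K(N_1)$ be two multilinear representations, $N_0,N_1\ge1$. For any connected circuit $\mathfrak c\in\mathcal Circ(\mathcal C)_{m,n}$ one has $$(\mu^0\hat\oplus\mu^1)(\mathfrak c)=\mu^0(\mathfrak c)\hat\oplus\mu^1(\mathfrak c).$$
   Context: $[N]=\{1,\dots,N\}$. PRO: a bigraded set $\mathcal P=\bigcup_{m,n\in\mathbb N}\mathcal P_{m,n}$ with associative operations $\leftrightarrow:\mathcal P_{m,n}\times\mathcal P_{m',n'}\to\mathcal P_{m+m',n+n'}$ and $\updownarrow:\mathcal P_{m,n}\times\mathcal P_{n,p}\to\mathcal P_{m,p}$ satisfying the interchange law $(p\updownarrow q)\leftrightarrow(p'\updownarrow q')=(p\leftrightarrow p')\updownarrow(q\leftrightarrow q')$, with graded vertical units $Id_n\in\mathcal P_{n,n}$ ($Id_m\updownarrow p=p\updownarrow Id_n=p$ for $p\in\mathcal P_{m,n}$, $Id_n=Id_1^{\leftrightarrow n}$ for $n\ge 1$) and a two-sided unit $\varepsilon=Id_0$ for $\leftrightarrow$. A morphism of PROs is a graded map preserving $\leftrightarrow$, $\updownarrow$ and all $Id_n$. Circuits: $\mathcal Circ(\mathcal C)$ is the PRO of circuits built from the chips in $\mathcal C$; an element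 of $\mathcal C_{n,m}$ is a chip with $n\geq 1$ outputs (top) and $m\geq 1$ inputs (bottom). Circuits are built inductively from the empty circuit $\oslash=Id_0$ (with $0$ outputs and $0$ inputs), the wire $Id_1$ (with $1$ output and $1$ input) and the chips, by juxtaposition $\leftrightarrow$ (juxtaposing with $\oslash$ changes nothing) and by connection $\updownarrow$ (joining the $i$-th input of the upper circuit to the $i$-th output of the lower one; connecting a row of wires changes nothing, and connecting $\oslash$ with itself gives $\oslash$). $\mathcal Circ(\mathcal C)$ is (isomorphic to) the free PRO on the bigraded set $\mathcal C$, so any graded map $\mathcal C\to\mathcal Q$ to a PRO extends uniquely to a PRO morphism. $\mathcal Circ(\mathcal C)_{m,n}$ is the set of circuits with $m$ outputs and $n$ inputs. A circuit is connected if it is not the juxtaposition of two non-empty circuits. Hypermatrices: $\mathbb K(N)=\bigcup_{p,q\ge 0}\mathbb K(N;p,q)$, where $\mathbb K(N;p,q)$ is the set of families $A=(A^I_J)_{I\in[N]^p,J\in[N]^q}$ with entries in $\mathbb K$ (with $\mathbb K(N;0,0)=\mathbb K$), is a PRO with $(A\leftrightarrow B)^{II'}_{JJ'}=A^I_JB^{I'}_{J'}$ (where $II'$ is the catenation of sequences) and $(A\updownarrow B)^I_J=\sum_KA^I_KB^K_J$; $Id_1$ is the $N\times N$ identity matrix and $Id_0=1$. A multilinear representation of a PRO $\mathcal P$ is a morphism of PROs $\mathcal P\to\mathbb K(N)$. Quasi-direct sum of hypermatrices: for $A\in\mathbb K(M;p,q)$ and $B\in\mathbb K(N;p,q)$,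 $A\hat\oplus B\in\mathbb K(M+N;p,q)$ is the hypermatrix whose entry at $(I,J)$ is $$\left\{\begin{array}{ll}A^I_J&\mbox{if }I\in[M]^p\mbox{ and }J\in[M]^q,\\ B^{I-[M,\dots,M]}_{J-[M,\dots,M]}&\mbox{if }I-[M,\dots,M]\in[N]^p\mbox{ and }J-[M,\dots,M]\in[N]^q,\\ 0&\mbox{otherwise.}\end{array}\right.$$ Quasi-direct sum of representations: $\mu^0\hat\oplus\mu^1:\mathcal Circ(\mathcal C)\to\mathbb K(N_0+N_1)$ is the unique representation with $(\mu^0\hat\oplus\mu^1)(\mathfrak c)=\mu^0(\mathfrak c)\hat\oplus\mu^1(\mathfrak c)$ for each chip $\mathfrak c\in\mathcal C$. *)

(* Defs.v *)
From HB Require Import structures.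
From mathcomp Require Import all_boot all_order all_algebra.
From mathcomp Require Import generic_quotient boolp.
Set Implicit Arguments.
Unset Strict Implicit.
Unset Printing Implicit Defensive.
Import GRing.Theory.

Local Open Scope nat_scope.
Local Open Scope quotient_scope.

Definition gcast (P : nat -> nat -> Type) m n m' n' (em : m = m') (en : n = n')
    (p : P m n) : P m' n' :=
  ecast i (P i n') em (ecast j (P m j) en p).

(* Equality in the bigraded set \bigcup_(m, n) P m n: the bidegrees agree and
   the elements are equal.  It is needed because the bidegrees of the two sides
   of, e.g., the associativity law are equal but not convertible. *)
Definition geq (P : nat -> nat -> Type) m n m' n' (p : P m n) (q : P m' n') :=
  exists (em : m = m') (en : n = n'), gcast em en p = q.

Record PRO := MkPRO {
  pro_sort :> nat -> nat -> Type;
  hcomp : forall m n m' n',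
    pro_sort m n -> pro_sort m' n' -> pro_sort (m + m') (n + n');
  vcomp : forall m n p, pro_sort m n -> pro_sort n p -> pro_sort m p;
  idn : forall n, pro_sort n n;
  hcompA : forall m n m' n' m'' n''
    (p : pro_sort m n) (q : pro_sort m' n') (r : pro_sort m'' n''),
    geq (hcomp p (hcomp q r)) (hcomp (hcomp p q) r);
  hcomp0l : forall m n (p : pro_sort m n), geq (hcomp (idn 0) p) p;
  hcomp0r : forall m n (p : pro_sort m n), geq (hcomp p (idn 0)) p;
  vcompA : forall m n p q
    (x : pro_sort m n) (y : pro_sort n p) (z : pro_sort p q),
    vcomp x (vcomp y z) = vcomp (vcomp x y) z;
  vcomp1l : forall m n (p : pro_sort m n), vcomp (idn m) p = p;
  vcomp1r : forall m n (p : pro_sort m n), vcomp p (idn n) = p;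
  interchange : forall m n p m' n' p'
    (x : pro_sort m n) (y : pro_sort n p)
    (x' : pro_sort m' n') (y' : pro_sort n' p'),
    hcomp (vcomp x y) (vcomp x' y') = vcomp (hcomp x x') (hcomp y y');
  (* together with the unit laws for idn 0: idn n is the n-th horizontal power
     of idn 1 *)
  idnS : forall n, geq (hcomp (idn 1) (idn n)) (idn n.+1)
}.

Arguments idn : clear implicits.

Record pro_mor (P Q : PRO) := ProMor {
  mor_fun :> forall m n, P m n -> Q m n;
  mor_hcomp : forall m n m' n' (p : P m n) (q : P m' n'),
    mor_fun (hcomp p q) = hcomp (mor_fun p) (mor_fun q);
  mor_vcomp : forall m n p (x : P m n) (y : P n p),
    mor_fun (vcomp x y) = vcomp (mor_fun x) (mor_fun y);
  mor_idn : forall n, mor_fun (idn P n) = idn Q n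
}.

Section Gcast.
Variable P : nat -> nat -> Type.

Lemma gcast_id m n (em : m = m) (en : n = n) (p : P m n) : gcast em en p = p.
Proof. by rewrite (eq_irrelevance em erefl) (eq_irrelevance en erefl). Qed.

Lemma geq_refl m n (p : P m n) : geq p p.
Proof. by exists erefl, erefl. Qed.

Lemma geqP m n (p q : P m n) : geq p q <-> p = q.
Proof.
split; last by move=> ->; exact: geq_refl.
by case=> em [en]; rewrite gcast_id.
Qed.

Lemma gcast_nat (Q : nat -> nat -> Type) (f : forall m n, P m n -> Q m n)
  m n m' n' (em : m = m') (en : n = n') (p : P m n) :
  f _ _ (gcast em en p) = gcast em en (f _ _ p).
Proof. by case: _ / em; case: _ / en. Qed.

End Gcast.

(* [C m n] is the set of chips with m outputs and n inputs; circuits are terms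
   modulo [ceq], so that they form the free PRO on [C]. *)
Inductive term (C : nat -> nat -> finType) : nat -> nat -> Type :=
| Empty : term C 0 0
| Wire : term C 1 1
| Chip m n of C m n : term C m n
| Juxt m n m' n' of term C m n & term C m' n' : term C (m + m') (n + n')
| Conn m n p of term C m n & term C n p : term C m p.

Arguments Empty {C}.
Arguments Wire {C}.

Fixpoint Wires C n : term C n n :=
  if n is n'.+1 then Juxt Wire (Wires C n') else Empty.

Inductive ceq (C : nat -> nat -> finType) :
    forall m n, term C m n -> term C m n -> Prop :=
| ceq_refl m n (a : term C m n) : ceq a a
| ceq_sym m n (a b : term C m n) of ceq a b : ceq b a
| ceq_trans m n (a b c : term C m n) of ceq a b & ceq b c : ceq a c
| ceq_juxt m n m' n' (a b : term C m n) (a' b' : term C m' n')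
    of ceq a b & ceq a' b' : ceq (Juxt a a') (Juxt b b')
| ceq_conn m n p (a b : term C m n) (a' b' : term C n p)
    of ceq a b & ceq a' b' : ceq (Conn a a') (Conn b b')
| ceq_juxtA m n m' n' m'' n''
    (a : term C m n) (b : term C m' n') (c : term C m'' n'') em en :
    ceq (gcast em en (Juxt a (Juxt b c))) (Juxt (Juxt a b) c)
| ceq_juxt0l m n (a : term C m n) : ceq (Juxt Empty a) a
| ceq_juxt0r m n (a : term C m n) em en : ceq (gcast em en (Juxt a Empty)) a
| ceq_connA m n p q (a : term C m n) (b : term C n p) (c : term C p q) :
    ceq (Conn a (Conn b c)) (Conn (Conn a b) c)
| ceq_conn1l m n (a : term C m n) : ceq (Conn (Wires C m) a) a
| ceq_conn1r m n (a : term C m n) : ceq (Conn a (Wires C n)) a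
| ceq_interchange m n p m' n' p' (a : term C m n) (b : term C n p)
    (a' : term C m' n') (b' : term C n' p') :
    ceq (Juxt (Conn a b) (Conn a' b')) (Conn (Juxt a a') (Juxt b b')).

HB.instance Definition _ (C : nat -> nat -> finType) m n :=
  gen_eqMixin (term C m n).
HB.instance Definition _ (C : nat -> nat -> finType) m n :=
  gen_choiceMixin (term C m n).

Section Circuits.
Variable C : nat -> nat -> finType.

Definition ceqb m n : rel (term C m n) := fun a b => `[< ceq a b >].

Lemma ceqb_refl m n : reflexive (@ceqb m n).
Proof. by move=> a; apply/asboolP; exact: ceq_refl. Qed.

Lemma ceqb_sym m n : symmetric (@ceqb m n).
Proof. by move=> a b; apply/asboolP/asboolP; exact: ceq_sym. Qed.

Lemma ceqb_trans m n : transitive (@ceqb m n).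
Proof.
by move=> b a c /asboolP ab /asboolP bc; apply/asboolP; exact: ceq_trans bc.
Qed.

Canonical ceqb_equiv m n :=
  EquivRel (@ceqb m n) (@ceqb_refl m n) (@ceqb_sym m n) (@ceqb_trans m n).

Definition circuit m n := {eq_quot (@ceqb m n)}.

Definition class m n (a : term C m n) : circuit m n := \pi_(circuit m n) a.

Lemma class_eq m n (a b : term C m n) : class a = class b <-> ceq a b.
Proof.
split; first by move/eqquotP/asboolP.
by move=> ab; apply/eqquotP/asboolP.
Qed.

Lemma classK m n (c : circuit m n) : class (repr c) = c.
Proof. exact: reprK. Qed.

Lemma ceq_repr m n (a : term C m n) : ceq (repr (class a)) a.
Proof. by apply/class_eq; rewrite classK. Qed.

Definition chip m n (x : C m n) : circuit m n := class (Chip x).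

Definition juxt m n m' n' (c : circuit m n) (d : circuit m' n') :
  circuit (m + m') (n + n') := class (Juxt (repr c) (repr d)).

Definition conn m n p (c : circuit m n) (d : circuit n p) : circuit m p :=
  class (Conn (repr c) (repr d)).

Definition wires n : circuit n n := class (Wires C n).

Lemma juxt_class m n m' n' (a : term C m n) (b : term C m' n') :
  juxt (class a) (class b) = class (Juxt a b).
Proof. by apply/class_eq/ceq_juxt; exact: ceq_repr. Qed.

Lemma conn_class m n p (a : term C m n) (b : term C n p) :
  conn (class a) (class b) = class (Conn a b).
Proof. by apply/class_eq/ceq_conn; exact: ceq_repr. Qed.

Lemma geq_class m n m' n' (em : m = m') (en : n = n')
  (a : term C m n) (b : term C m' n') :
  ceq (gcast em en a) b -> geq (class a) (class b).
Proof.
move=> /class_eq h; exists em, en.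
by rewrite -h (gcast_nat (@class)).
Qed.

Lemma juxtA m n m' n' m'' n''
  (p : circuit m n) (q : circuit m' n') (r : circuit m'' n'') :
  geq (juxt p (juxt q r)) (juxt (juxt p q) r).
Proof.
rewrite -(classK p) -(classK q) -(classK r) !juxt_class.
exact: geq_class (addnA _ _ _) (addnA _ _ _) _ _ (ceq_juxtA _ _ _ _ _).
Qed.

Lemma juxt0l m n (p : circuit m n) : geq (juxt (wires 0) p) p.
Proof.
apply/geqP; rewrite -(classK p) juxt_class.
by apply/class_eq; exact: ceq_juxt0l.
Qed.

Lemma juxt0r m n (p : circuit m n) : geq (juxt p (wires 0)) p.
Proof.
rewrite -(classK p) juxt_class.
exact: geq_class (addn0 _) (addn0 _) _ _ (ceq_juxt0r _ _ _).
Qed.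

Lemma connA m n p q (x : circuit m n) (y : circuit n p) (z : circuit p q) :
  conn x (conn y z) = conn (conn x y) z.
Proof.
rewrite -(classK x) -(classK y) -(classK z) !conn_class.
by apply/class_eq; exact: ceq_connA.
Qed.

Lemma conn1l m n (p : circuit m n) : conn (wires m) p = p.
Proof.
rewrite -(classK p) /wires conn_class.
by apply/class_eq; exact: ceq_conn1l.
Qed.

Lemma conn1r m n (p : circuit m n) : conn p (wires n) = p.
Proof.
rewrite -(classK p) /wires conn_class.
by apply/class_eq; exact: ceq_conn1r.
Qed.

Lemma juxt_conn m n p m' n' p' (x : circuit m n) (y : circuit n p)
  (x' : circuit m' n') (y' : circuit n' p') :
  juxt (conn x y) (conn x' y') = conn (juxt x x') (juxt y y').
Proof.
rewrite -(classK x) -(classK y) -(classK x') -(classK y').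
rewrite 2!conn_class 3!juxt_class conn_class.
by apply/class_eq; exact: ceq_interchange.
Qed.

Lemma wires1 : wires 1 = class Wire.
Proof. apply/class_eq; exact: (@ceq_juxt0r C 1 1 Wire erefl erefl). Qed.

Lemma wiresS n : geq (juxt (wires 1) (wires n)) (wires n.+1).
Proof. by apply/geqP; rewrite wires1 juxt_class. Qed.

Definition Circ : PRO :=
  MkPRO juxtA juxt0l juxt0r connA conn1l conn1r juxt_conn wiresS.

Definition nonempty m n (p : Circ m n) : Prop := ~ geq p (idn Circ 0).

Definition connected m n (c : Circ m n) : Prop :=
  ~ exists m1 n1 m2 n2 (p : Circ m1 n1) (q : Circ m2 n2),
      [/\ nonempty p, nonempty q & geq (hcomp p q) c].

Section Lift.
Variables (Q : PRO) (f : forall m n, C m n -> Q m n).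

Fixpoint eval m n (a : term C m n) : Q m n :=
  match a in term _ m n return Q m n with
  | Empty => idn Q 0
  | Wire => idn Q 1
  | Chip _ _ x => f x
  | Juxt _ _ _ _ a b => hcomp (eval a) (eval b)
  | Conn _ _ _ a b => vcomp (eval a) (eval b)
  end.

Lemma eval_Wires n : eval (Wires C n) = idn Q n.
Proof. by elim: n => //= n ->; apply/geqP; exact: idnS. Qed.

Lemma eval_ceq m n (a b : term C m n) : ceq a b -> eval a = eval b.
Proof.
elim=> {m n a b} //=.
- by move=> m n a b c _ -> _ ->.
- by move=> m n m' n' a b a' b' _ -> _ ->.
- by move=> m n p a b a' b' _ -> _ ->.
- move=> m n m' n' m'' n'' a b c em en; rewrite (gcast_nat eval) /=.
  have [em' [en' <-]] := hcompA (eval a) (eval b) (eval c).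
  by rewrite (eq_irrelevance em em') (eq_irrelevance en en').
- by move=> m n a; apply/geqP; exact: hcomp0l.
- move=> m n a em en; rewrite (gcast_nat eval) /=.
  have [em' [en' h]] := hcomp0r (eval a).
  by rewrite (eq_irrelevance em em') (eq_irrelevance en en').
- by move=> *; rewrite vcompA.
- by move=> *; rewrite eval_Wires vcomp1l.
- by move=> *; rewrite eval_Wires vcomp1r.
- by move=> *; rewrite interchange.
Qed.

Definition lift_fun m n (c : Circ m n) : Q m n := eval (repr c).

Lemma lift_class m n (a : term C m n) : lift_fun (class a) = eval a.
Proof. by apply: eval_ceq; exact: ceq_repr. Qed.

Lemma lift_hcomp m n m' n' (p : Circ m n) (q : Circ m' n') :
  lift_fun (hcomp p q) = hcomp (lift_fun p) (lift_fun q).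
Proof. exact: lift_class. Qed.

Lemma lift_vcomp m n p (x : Circ m n) (y : Circ n p) :
  lift_fun (vcomp x y) = vcomp (lift_fun x) (lift_fun y).
Proof. exact: lift_class. Qed.

Lemma lift_idn n : lift_fun (idn Circ n) = idn Q n.
Proof. by rewrite lift_class eval_Wires. Qed.

Definition lift : pro_mor Circ Q := ProMor lift_hcomp lift_vcomp lift_idn.

Lemma lift_chip m n (x : C m n) : lift _ _ (chip x) = f x.
Proof. exact: lift_class. Qed.

Lemma lift_unique (g : pro_mor Circ Q) :
  (forall m n (x : C m n), g _ _ (chip x) = f x) ->
  forall m n (c : Circ m n), g _ _ c = lift _ _ c.
Proof.
move=> gf m n c; rewrite -[c]classK; set a := repr c; clearbody a.
rewrite [RHS]lift_class; elim: a => {m n c} /=.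
- exact: (mor_idn g 0).
- by rewrite -wires1; exact: (mor_idn g 1).
- by move=> m n x; exact: gf.
- by move=> m n m' n' a <- b <-; rewrite -mor_hcomp /= juxt_class.
- by move=> m n p a <- b <-; rewrite -mor_vcomp /= conn_class.
Qed.

End Lift.
End Circuits.

Section Hypermatrices.
Variables (K : comPzSemiRingType) (N : nat).
Local Open Scope ring_scope.

Definition hypermatrix p q := {ffun p.-tuple 'I_N * q.-tuple 'I_N -> K}.

Definition ltup T p p' (I : (p + p').-tuple T) : p.-tuple T :=
  [tuple tnth I (lshift p' i) | i < p].
Definition rtup T p p' (I : (p + p').-tuple T) : p'.-tuple T :=
  [tuple tnth I (rshift p i) | i < p'].

Definition hm_hcomp p q p' q' (A : hypermatrix p q) (B : hypermatrix p' q') :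
    hypermatrix (p + p') (q + q') :=
  [ffun IJ => A (ltup IJ.1, ltup IJ.2) * B (rtup IJ.1, rtup IJ.2)].

Definition hm_vcomp p q r (A : hypermatrix p q) (B : hypermatrix q r) :
    hypermatrix p r :=
  [ffun IJ => \sum_(L : q.-tuple 'I_N) A (IJ.1, L) * B (L, IJ.2)].

Definition hm_id n : hypermatrix n n := [ffun IJ => (IJ.1 == IJ.2)%:R].

Lemma ltup_cat T p p' (I : p.-tuple T) (I' : p'.-tuple T) :
  ltup [tuple of I ++ I'] = I.
Proof. by apply: eq_from_tnth => i; rewrite tnth_mktuple tnth_lshift. Qed.

Lemma rtup_cat T p p' (I : p.-tuple T) (I' : p'.-tuple T) :
  rtup [tuple of I ++ I'] = I'.
Proof. by apply: eq_from_tnth => i; rewrite tnth_mktuple tnth_rshift. Qed.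

Lemma cat_ltup_rtup T p p' (I : (p + p').-tuple T) :
  [tuple of ltup I ++ rtup I] = I.
Proof.
apply: eq_from_tnth => i; rewrite -(splitK i).
by case: split => j /=; rewrite ?tnth_lshift ?tnth_rshift tnth_mktuple.
Qed.

Lemma hm_hcompE p q p' q' (A : hypermatrix p q) (B : hypermatrix p' q')
  (I : p.-tuple 'I_N) (I' : p'.-tuple 'I_N)
  (J : q.-tuple 'I_N) (J' : q'.-tuple 'I_N) :
  hm_hcomp A B ([tuple of I ++ I'], [tuple of J ++ J']) = A (I, J) * B (I', J').
Proof. by rewrite ffunE /= !ltup_cat !rtup_cat. Qed.

Lemma gcast_hm p q p' q' (ep : p = p') (eq : q = q') (A : hypermatrix p q) I J :
  gcast ep eq A (I, J) = A (tcast (esym ep) I, tcast (esym eq) J).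
Proof. by case: _ / ep I; case: _ / eq J. Qed.

Lemma tnth_tcast T p p' (e : p = p') (I : p.-tuple T) i :
  tnth (tcast e I) i = tnth I (cast_ord (esym e) i).
Proof. by case: _ / e i => i; congr tnth; apply: val_inj. Qed.

Lemma ltup_tcast T p p' p'' e (I : ((p + p') + p'').-tuple T) :
  ltup (tcast e I : (p + (p' + p'')).-tuple T) = ltup (ltup I).
Proof.
apply: eq_from_tnth => i; rewrite !tnth_mktuple tnth_tcast.
by congr tnth; apply: val_inj.
Qed.

Lemma lrtup_tcast T p p' p'' e (I : ((p + p') + p'').-tuple T) :
  ltup (rtup (tcast e I : (p + (p' + p'')).-tuple T)) = rtup (ltup I).
Proof.
apply: eq_from_tnth => i; rewrite !tnth_mktuple tnth_tcast.
by congr tnth; apply: val_inj.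
Qed.

Lemma rtup_tcast T p p' p'' e (I : ((p + p') + p'').-tuple T) :
  rtup (rtup (tcast e I : (p + (p' + p'')).-tuple T)) = rtup I.
Proof.
apply: eq_from_tnth => i; rewrite !tnth_mktuple tnth_tcast.
by congr tnth; apply: val_inj; rewrite /= addnA.
Qed.

Lemma hm_hcompA p q p' q' p'' q''
  (A : hypermatrix p q) (B : hypermatrix p' q') (D : hypermatrix p'' q'') :
  geq (hm_hcomp A (hm_hcomp B D)) (hm_hcomp (hm_hcomp A B) D).
Proof.
exists (addnA _ _ _), (addnA _ _ _); apply/ffunP => -[I J].
rewrite gcast_hm !ffunE /=.
by rewrite !ltup_tcast !lrtup_tcast !rtup_tcast mulrA.
Qed.

Lemma hm_hcomp0l p q (A : hypermatrix p q) : geq (hm_hcomp (hm_id 0) A) A.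
Proof.
exists erefl, erefl; apply/ffunP => -[I J].
rewrite gcast_hm !ffunE /= [ltup _]tuple0 [X in _ == X]tuple0 eqxx mul1r.
by congr (A (_, _)); apply: eq_from_tnth => i; rewrite tnth_mktuple;
  congr tnth; apply: val_inj.
Qed.

Lemma hm_hcomp0r p q (A : hypermatrix p q) : geq (hm_hcomp A (hm_id 0)) A.
Proof.
exists (addn0 _), (addn0 _); apply/ffunP => -[I J].
rewrite gcast_hm !ffunE /= [rtup _]tuple0 [X in _ == X]tuple0 eqxx mulr1.
by congr (A (_, _)); apply: eq_from_tnth => i; rewrite tnth_mktuple tnth_tcast;
  congr tnth; apply: val_inj.
Qed.

Lemma hm_vcompA p q r s
  (A : hypermatrix p q) (B : hypermatrix q r) (D : hypermatrix r s) :
  hm_vcomp A (hm_vcomp B D) = hm_vcomp (hm_vcomp A B) D.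
Proof.
apply/ffunP => -[I J]; rewrite !ffunE /=.
under eq_bigr => L _ do rewrite ffunE big_distrr.
rewrite exchange_big; apply: eq_bigr => L _ /=; rewrite ffunE big_distrl /=.
by apply: eq_bigr => L' _; rewrite mulrA.
Qed.

Lemma hm_vcomp1l p q (A : hypermatrix p q) : hm_vcomp (hm_id p) A = A.
Proof.
apply/ffunP => -[I J]; rewrite ffunE (bigD1 I) //= ffunE eqxx mul1r.
rewrite big1 ?addr0 // => L; rewrite eq_sym ffunE /= => /negPf ->.
by rewrite mul0r.
Qed.

Lemma hm_vcomp1r p q (A : hypermatrix p q) : hm_vcomp A (hm_id q) = A.
Proof.
apply/ffunP => -[I J]; rewrite ffunE (bigD1 J) //= ffunE eqxx mulr1.
rewrite big1 ?addr0 // => L; rewrite ffunE /= => /negPf ->.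
by rewrite mulr0.
Qed.

Lemma hm_interchange p q r p' q' r'
  (A : hypermatrix p q) (B : hypermatrix q r)
  (A' : hypermatrix p' q') (B' : hypermatrix q' r') :
  hm_hcomp (hm_vcomp A B) (hm_vcomp A' B') =
  hm_vcomp (hm_hcomp A A') (hm_hcomp B B').
Proof.
apply/ffunP => -[I J]; rewrite !ffunE /= big_distrlr /=.
rewrite pair_big /=.
rewrite (reindex (fun L : (q + q').-tuple 'I_N => (ltup L, rtup L))) /=.
  by apply: eq_bigr => L _; rewrite !ffunE /= mulrACA.
exists (fun LL : q.-tuple _ * q'.-tuple _ => [tuple of LL.1 ++ LL.2])
  => [L _|[L L'] _] /=.
  exact: cat_ltup_rtup.
by rewrite ltup_cat rtup_cat.
Qed.

Lemma hm_idS n : geq (hm_hcomp (hm_id 1) (hm_id n)) (hm_id n.+1).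
Proof.
apply/geqP/ffunP => -[I J]; rewrite !ffunE /= -natrM mulnb.
congr (nat_of_bool _)%:R; apply/andP/eqP => [[/eqP l /eqP r]|->] //.
rewrite -(cat_ltup_rtup (I : (1 + n).-tuple _)).
by rewrite -(cat_ltup_rtup (J : (1 + n).-tuple _)) l r.
Qed.

Definition Hyper : PRO :=
  MkPRO hm_hcompA hm_hcomp0l hm_hcomp0r hm_vcompA hm_vcomp1l hm_vcomp1r
    hm_interchange hm_idS.

End Hypermatrices.

Definition multilinear_rep (P : PRO) (K : comPzSemiRingType) (N : nat) :=
  pro_mor P (Hyper K N).

Section QuasiDirectSum.
Variables (K : comPzSemiRingType) (M N : nat).
Local Open Scope ring_scope.

(* Over indices counted from 0, [M] sits in [M + N] through [lshift N], and
   I - [M, ..., M] lies in [N]^p when I is the image under [rshift M] of that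
   (unique) sequence. *)
Definition low p (I : p.-tuple 'I_(M + N)) : option (p.-tuple 'I_M) :=
  [pick I' | map_tuple (lshift N) I' == I].
Definition high p (I : p.-tuple 'I_(M + N)) : option (p.-tuple 'I_N) :=
  [pick I' | map_tuple (@rshift M N) I' == I].

Lemma lowK p (I : p.-tuple 'I_M) : low (map_tuple (lshift N) I) = Some I.
Proof.
rewrite /low; case: pickP => [I'|/(_ I)]; last by rewrite eqxx.
by move=> /eqP/(congr1 val)/(inj_map (@lshift_inj _ _))/val_inj ->.
Qed.

Lemma highK p (I : p.-tuple 'I_N) : high (map_tuple (@rshift M N) I) = Some I.
Proof.
rewrite /high; case: pickP => [I'|/(_ I)]; last by rewrite eqxx.
by move=> /eqP/(congr1 val)/(inj_map (@rshift_inj _ _))/val_inj ->.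
Qed.

Definition qdsum p q (A : hypermatrix K M p q) (B : hypermatrix K N p q) :
    hypermatrix K (M + N) p q :=
  [ffun IJ =>
    if (low IJ.1, low IJ.2) is (Some I', Some J') then A (I', J')
    else if (high IJ.1, high IJ.2) is (Some I', Some J') then B (I', J')
    else 0].

End QuasiDirectSum.

Definition qdsum_rep (C : nat -> nat -> finType) (K : comPzSemiRingType)
    (N0 N1 : nat) (mu0 : multilinear_rep (Circ C) K N0)
    (mu1 : multilinear_rep (Circ C) K N1) :
    multilinear_rep (Circ C) K (N0 + N1) :=
  lift (Q := Hyper K (N0 + N1))
    (fun m n (x : C m n) => qdsum (mu0 m n (chip x)) (mu1 m n (chip x))).

(* Main.v *)
Require Import Defs.
From mathcomp Require Import all_boot all_order all_algebra.

(** Write nu for the quasi-direct sum of mu0 and mu1.  An entry of nu c is a sum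
    over all labellings of the wires of c by indices in [N0 + N1].  Call an
    index [true] if it comes from the first summand and [false] otherwise: the
    quasi-direct sum of two chips vanishes unless all the labels around the
    chip have one colour, so only colourings of the wires that are constant
    around each chip contribute ([coloring], [coloring_eval]).

    Since every chip has an input and an output, a colour leaving the top of a
    circuit always reaches its bottom.  Hence if all outputs have colour b, then
    so do all inputs and all inner wires, and the sum over the labellings is the
    one that computes mu0 c or mu1 c ([eval_embed]).  This half of the result
    holds for every circuit.

    Connectedness is used to exclude mixed colourings of the boundary.  If the
    colour changes between two neighbouring outputs, the boundary between
    the two colours can be followed downwards: it never crosses a chip, and
    it leaves the circuit between two inputs with the same two colours.  The
    circuit is therefore the juxtaposition of what lies to the left and to the
    right of this line ([coloring_cut]), and both parts are non-empty. *)

Set Implicit Arguments.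
Unset Strict Implicit.
Unset Printing Implicit Defensive.
Import GRing.Theory.

Local Open Scope nat_scope.

(** * Sequences of colours *)

Lemma last_nseq (b d : bool) k : last d (nseq k b) = if k is 0 then d else b.
Proof. by case: k => //= k; elim: k. Qed.

Lemma head_nseq (b d : bool) k : head d (nseq k b) = if k is 0 then d else b.
Proof. by case: k. Qed.

Lemma head_cat (T : Type) (d : T) s t : head d (s ++ t) = head (head d t) s.
Proof. by case: s. Qed.

Lemma cat_eq_cat (T : Type) (x1 x2 s1 s2 : seq T) : x1 ++ x2 = s1 ++ s2 ->
  (exists u, x1 = s1 ++ u /\ s2 = u ++ x2) \/
  (exists u, s1 = x1 ++ u /\ x2 = u ++ s2).
Proof.
elim: x1 s1 => [|k x1 IH] [|l s1] /= => [->|->|<-|[<- /IH]].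
- by left; exists [::].
- by right; exists (l :: s1).
- by left; exists (k :: x1).
- by case=> -[u [-> ->]]; [left | right]; exists u.
Qed.

(** * Vertical cuts of circuits *)

Lemma geq_sym (P : nat -> nat -> Type) m n m' n' (p : P m n) (q : P m' n') :
  Defs.geq p q -> Defs.geq q p.
Proof.
by case=> em [en]; case: _ / em q; case: _ / en => q <-; exact: geq_refl.
Qed.

Section Cuts.
Variable C : nat -> nat -> finType.

(** Only the bidegree of the left part is recorded; that of the right part is
    then determined, and leaving it implicit avoids subtractions in types. *)
Definition cut m n (c : circuit C m n) (i j : nat) : Prop :=
  exists m2 n2 (p : circuit C i j) (q : circuit C m2 n2), Defs.geq (juxt p q) c.

Lemma cut_left m n (c : circuit C m n) : cut c 0 0.
Proof. by exists m, n, (wires C 0), c; exact: juxt0l. Qed.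

Lemma cut_right m n (c : circuit C m n) : cut c m n.
Proof. by exists 0, 0, c, (wires C 0); exact: juxt0r. Qed.

Lemma cut_juxtl m n m' n' (c : circuit C m n) (d : circuit C m' n') i j :
  cut c i j -> cut (juxt c d) i j.
Proof.
case=> m2 [n2 [p [q [em [en]]]]].
case: _ / em c; case: _ / en => c <-.
by exists (m2 + m'), (n2 + n'), p, (juxt q d); exact: juxtA.
Qed.

Lemma cut_juxtr m n m' n' (c : circuit C m n) (d : circuit C m' n') i j :
  cut d i j -> cut (juxt c d) (m + i) (n + j).
Proof.
case=> m2 [n2 [p [q [em [en]]]]].
case: _ / em d; case: _ / en => d <-.
by exists m2, n2, (juxt c p), q; apply: geq_sym; exact: juxtA.
Qed.

(** Two cuts meeting at the same place of the interface can be joined, by the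
    interchange law. *)
Lemma cut_conn m n r (c : circuit C m n) (d : circuit C n r) i j k :
  cut c i j -> cut d j k -> cut (conn c d) i k.
Proof.
case=> m2 [n2 [p [q [em [en]]]]].
case: _ / em c; case: _ / en d => d c <- {c}.
case=> m3 [n3 [p' [q' [em [en]]]]].
have e : m3 = n2 by exact: addnI em.
case: _ / en d => d; subst m3.
rewrite (eq_irrelevance em erefl) /= => <-.
exists m2, n3, (conn p p'), (conn q q').
by rewrite juxt_conn; exact: geq_refl.
Qed.

(** * Colourings of the boundary *)

(** [coloring a x y] holds when the wires of [a] can be coloured, with one
    colour around each chip, so that the outputs read [x] and the inputs
    read [y]. *)
Fixpoint coloring m n (a : term C m n) (x y : seq bool) : Prop :=
  match a with
  | Empty => x = [::] /\ y = [::]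
  | Wire => exists b, x = [:: b] /\ y = [:: b]
  | Chip m n _ => exists b, x = nseq m b /\ y = nseq n b
  | Juxt _ _ _ _ a b => exists x1 x2 y1 y2,
      [/\ x = x1 ++ x2, y = y1 ++ y2, coloring a x1 y1 & coloring b x2 y2]
  | Conn _ _ _ a b => exists z, coloring a x z /\ coloring b z y
  end.

Lemma coloring_size m n (a : term C m n) x y :
  coloring a x y -> size x = m /\ size y = n.
Proof.
elim: a x y => {m n} /=.
- by move=> x y [-> ->].
- by move=> x y [b [-> ->]].
- by move=> m n _ x y [b [-> ->]]; rewrite !size_nseq.
- move=> m n m' n' a IHa b IHb _ _ [x1 [x2 [y1 [y2 [-> -> /IHa[? ?]]]]]].
  by move=> /IHb[? ?]; rewrite !size_cat; split; congr addn.
- by move=> m n p a IHa b IHb x y [z [/IHa[? _] /IHb[_ ?]]].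
Qed.

Hypothesis C_pos : forall m n : nat, C m n -> 0 < m /\ 0 < n.

(** This is where every chip must have both an input and an output: a chip
    without outputs, say, could have inputs of any colour. *)
Lemma coloring_all m n (a : term C m n) x y b :
  coloring a x y -> all (pred1 b) x = all (pred1 b) y.
Proof.
elim: a x y => {m n} /=.
- by move=> x y [-> ->].
- by move=> x y [c [-> ->]].
- move=> m n /C_pos[m_gt0 n_gt0] x y [c [-> ->]].
  by rewrite !all_nseq !eqn0Ngt m_gt0 n_gt0.
- move=> m n m' n' a IHa d IHd _ _ [x1 [x2 [y1 [y2 [-> -> /IHa e]]]]].
  by move=> /IHd e'; rewrite !all_cat e e'.
- by move=> m n p a IHa d IHd x y [z [/IHa-> /IHd->]].
Qed.

(** The default values stand for the colours of the neighbours, so that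
    a juxtaposition with an empty circuit needs no separate treatment. *)
Lemma coloring_ends m n (a : term C m n) x y d :
  coloring a x y -> head d x = head d y /\ last d x = last d y.
Proof.
elim: a x y d => {m n} /=.
- by move=> x y d [-> ->].
- by move=> x y d [c [-> ->]].
- move=> m n /C_pos[m_gt0 n_gt0] x y d [c [-> ->]].
  by rewrite !head_nseq !last_nseq; case: m n m_gt0 n_gt0 => [|m] [|n].
- move=> m n m' n' a IHa b IHb _ _ d [x1 [x2 [y1 [y2 [-> -> ca cb]]]]].
  have [hb _] := IHb _ _ d cb; have [ha _] := IHa _ _ (head d x2) ca.
  have [_ la] := IHa _ _ d ca; have [_ lb] := IHb _ _ (last d x1) cb.
  by rewrite !head_cat !last_cat ha hb lb la.
- move=> m n p a IHa b IHb x y d [z [ca cb]].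
  have [-> ->] := IHa _ _ d ca.
  exact: IHb.
Qed.

(** When all ports have one colour, colours can only change at the two sides of
    the circuit, where the trivial cuts are available. *)
Lemma coloring_cut_corolla m n (c : circuit C m n) b d e
    (s1 s2 : seq bool) :
  0 < m -> 0 < n -> nseq m b = s1 ++ s2 -> last d s1 != head e s2 ->
  exists t1 t2, [/\ nseq n b = t1 ++ t2, last d t1 = last d s1,
                    head e t2 = head e s2 & cut c (size s1) (size t1)].
Proof.
move=> m_gt0 n_gt0 es.
have em : m = size s1 + size s2 by rewrite -size_cat -es size_nseq.
have mono s : {subset s <= nseq m b} -> s = nseq (size s) b.
  by move=> sub; apply/all_pred1P/allP => k /sub /nseqP[->] /=.
have e1 : s1 = nseq (size s1) b by apply: mono => k; rewrite es mem_cat => ->.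
have e2 : s2 = nseq (size s2) b.
  by apply: mono => k; rewrite es mem_cat orbC => ->.
rewrite e1 e2 last_nseq head_nseq !size_nseq.
case E1: (size s1) em => [|k1]; case E2: (size s2) => [|k2] em ne.
- by rewrite em in m_gt0.
- exists [::], (nseq n b); split => //; last exact: cut_left.
  by rewrite head_nseq; case: n n_gt0 {c}.
- exists (nseq n b), [::]; rewrite cats0; split => //.
    by rewrite last_nseq; case: n n_gt0 {c}.
  by rewrite size_nseq -[k1.+1]addn0 -em; exact: cut_right.
- by rewrite eqxx in ne.
Qed.

(** The line separating two neighbouring colours [last d s1] and [head e s2]
    on the outputs is followed downwards until it leaves the circuit.  The
    defaults [d] and [e] are the colours on the two sides of the
    circuit: in a juxtaposition the line may lie between the two parts, and the
    neighbour of one part is then an end of the other. *)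
Lemma coloring_cut m n (a : term C m n) d e s1 s2 y :
  coloring a (s1 ++ s2) y -> last d s1 != head e s2 ->
  exists t1 t2, [/\ y = t1 ++ t2, last d t1 = last d s1, head e t2 = head e s2
                  & cut (class a) (size s1) (size t1)].
Proof.
elim: a d e s1 s2 y => {m n} /=.
- move=> d e [|k s1] [|l s2] y [// _ ->] ne.
  by exists [::], [::]; split => //; exact: cut_left.
- move=> d e s1 s2 y [b [es ->]].
  exact: (@coloring_cut_corolla 1 1 (class Wire) b).
- move=> m n x d e s1 s2 y [b [es ->]].
  have [m_gt0 n_gt0] := C_pos x.
  exact: coloring_cut_corolla (esym es).
- move=> m n m' n' a IHa b IHb d e s1 s2 y [x1 [x2 [y1 [y2 [es -> ca cb]]]]].
  rewrite -juxt_class; case: (cat_eq_cat (esym es)) => -[u []].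
  + move=> ex ->; rewrite head_cat; subst x1.
    have [-> _] := coloring_ends e cb => ne.
    have [t1 [t2 [-> l1 h2 ab]]] := IHa _ _ _ _ _ ca ne.
    exists t1, (t2 ++ y2); rewrite head_cat catA.
    by split => //; exact: cut_juxtl.
  + move=> -> ex; rewrite last_cat; subst x2.
    have [_ ->] := coloring_ends d ca => ne.
    have [t1 [t2 [-> l1 h2 ab]]] := IHb _ _ _ _ _ cb ne.
    exists (y1 ++ t1), t2; rewrite last_cat catA; split => //.
    have [e1 e2] := coloring_size ca.
    by rewrite !size_cat e1 e2; exact: cut_juxtr.
- move=> m n p a IHa b IHb d e s1 s2 y [z [ca cb]] ne.
  have [t1 [t2 [ez l1 h1 cuta]]] := IHa _ _ _ _ _ ca ne.
  rewrite {}ez -l1 -h1 in cb ne.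
  have [u1 [u2 [ey l2 h2 cutb]]] := IHb _ _ _ _ _ cb ne.
  exists u1, u2; rewrite l2 h2; split => //.
  by rewrite -conn_class; exact: cut_conn cuta cutb.
Qed.

(** A change of colour between two outputs would yield a cut with both parts
    non-empty.  It is enough to look at the outputs: if they all have colour [b],
    so have the inputs. *)
Lemma coloring_connected m n (a : term C m n) x y :
  connected (class a : Circ C m n) -> coloring a x y ->
  exists b, all (pred1 b) x /\ all (pred1 b) y.
Proof.
move=> conn_a ca; exists (head true x); rewrite -(coloring_all _ ca).
suff allx : all (pred1 (head true x)) x by [].
apply: contra_notT conn_a; set b := head true x => nall.
have [x1 [x2 [ex lx hx x1N]]] : exists x1 x2,
    [/\ x = x1 ++ x2, last b x1 = b, head b x2 != b & 0 < size x1].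
  (* Cut [x] before its first entry that differs from its head. *)
  move: nall; rewrite -has_predC /b; case: x {ca b} => [|k s] //= .
  rewrite eqxx /= => /split_find[l s1 s2 lk s1P].
  exists (k :: s1), (l :: s2); rewrite cat_rcons; split => //=.
  elim/last_ind: s1 s1P => //= s1 q _.
  by rewrite has_rcons last_rcons negb_or /= negbK => /andP[/eqP].
(* The default [b] makes both sides of the circuit look like the head of [x],
   so the right part of the cut has an output at which the colour is not [b]. *)
have [] := @coloring_cut _ _ a b b x1 x2 y; first by rewrite -ex.
  by rewrite lx eq_sym.
move=> t1 [t2 [ey lt ht [m2 [n2 [p [q pq]]]]]].
have [em _] := coloring_size ca.
exists (size x1), (size t1), m2, n2, p, q; split => //.
- by case=> e0 _; rewrite e0 in x1N.
- case=> e0 _; case: pq => e1 _.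
  move: em; rewrite ex size_cat -e1 => /addnI; rewrite e0.
  by case: (x2) hx => //=; rewrite eqxx.
Qed.

End Cuts.

(** * Evaluation of coloured hypermatrices *)

Section Eval.
Variables (K : comPzSemiRingType) (C : nat -> nat -> finType) (N : nat).
Variable g : forall m n, C m n -> Hyper K N m n.
Variable col : 'I_N -> bool.
Hypothesis g_col : forall m n (x : C m n) (I : m.-tuple 'I_N) (J : n.-tuple 'I_N),
  (g x (I, J) != 0)%R ->
  exists b, map col I = nseq m b /\ map col J = nseq n b.

Lemma coloring_eval m n (a : term C m n) (I : m.-tuple 'I_N)
    (J : n.-tuple 'I_N) :
  (eval g a (I, J) != 0)%R -> coloring a (map col I) (map col J).
Proof.
elim: a I J => {m n} /=.
- by move=> I J _; rewrite [I]tuple0 [J]tuple0.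
- move=> I J; rewrite ffunE /=; case: (I =P J) => [-> _|]; last by rewrite eqxx.
  by case/tupleP: J => k J; exists (col k); rewrite [J]tuple0.
- by move=> m n x I J; exact: g_col.
- move=> m n m' n' a IHa b IHb I J; rewrite ffunE /= => ne.
  have nea : (eval g a (ltup I, ltup J) != 0)%R.
    by apply: contra_neq ne => ->; rewrite mul0r.
  have neb : (eval g b (rtup I, rtup J) != 0)%R.
    by apply: contra_neq ne => ->; rewrite mulr0.
  exists (map col (ltup I)), (map col (rtup I)).
  exists (map col (ltup J)), (map col (rtup J)).
  rewrite -!map_cat; split; [| |exact: IHa|exact: IHb].
    by rewrite -[in LHS](cat_ltup_rtup I).
  by rewrite -[in LHS](cat_ltup_rtup J).
- move=> m n p a IHa b IHb I J; rewrite ffunE /= => ne.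
  have [L] : exists L, (eval g a (I, L) * eval g b (L, J) != 0)%R.
    apply/existsP; apply: contra_neqT ne => /existsPn z.
    by apply: big1 => L _; apply/eqP; rewrite -[_ == _]negbK.
  move=> {}ne; exists (map col L); split.
    by apply: IHa; apply: contra_neq ne => ->; rewrite mul0r.
  by apply: IHb; apply: contra_neq ne => ->; rewrite mulr0.
Qed.

Hypothesis C_pos : forall m n : nat, C m n -> 0 < m /\ 0 < n.
Variables (M : nat) (f : forall m n, C m n -> Hyper K M m n).
Variables (e : 'I_M -> 'I_N) (b : bool).
Hypothesis e_inj : injective e.
Hypothesis e_col : forall k, col (e k) = b.
Hypothesis e_onto : forall k, col k = b -> exists l, k = e l.
Hypothesis g_embed : forall m n (x : C m n) I J,
  g x (map_tuple e I, map_tuple e J) = f x (I, J).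

Lemma map_tuple_embed p (I : p.-tuple 'I_N) :
  all (pred1 b) (map col I) -> exists I', I = map_tuple e I'.
Proof.
rewrite all_map => /all_tnthP h.
have h' i : exists l, tnth I i == e l.
  by have [l ->] := e_onto (eqP (h i)); exists l.
exists [tuple xchoose (h' i) | i < p]; apply: eq_from_tnth => i.
by rewrite tnth_map tnth_mktuple; apply/eqP; exact: (xchooseP (h' i)).
Qed.

Lemma all_map_embed p (I : p.-tuple 'I_M) :
  all (pred1 b) (map col (map_tuple e I)).
Proof. by rewrite /= -map_comp all_map; apply/allP => k _ /=; rewrite e_col. Qed.

Lemma map_tuple_inj p : injective (fun I : p.-tuple 'I_M => map_tuple e I).
Proof. by move=> I J /(congr1 val)/(inj_map e_inj)/val_inj. Qed.

Lemma map_ltup p p' (I : (p + p').-tuple 'I_M) :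
  ltup (map_tuple e I) = map_tuple e (ltup I).
Proof. by apply: eq_from_tnth => i; rewrite !(tnth_map, tnth_mktuple). Qed.

Lemma map_rtup p p' (I : (p + p').-tuple 'I_M) :
  rtup (map_tuple e I) = map_tuple e (rtup I).
Proof. by apply: eq_from_tnth => i; rewrite !(tnth_map, tnth_mktuple). Qed.

(** If the outputs have colour [b], only inner labellings of colour [b]
    contribute to a connection, because all labels [L] of the interface are
    then forced to have this colour. *)
Lemma eval_embed m n (a : term C m n) I J :
  eval g a (map_tuple e I, map_tuple e J) = eval f a (I, J).
Proof.
elim: a I J => {m n} /=.
- by move=> I J; rewrite !ffunE /= [I]tuple0 [J]tuple0 !eqxx.
- by move=> I J; rewrite !ffunE /= (inj_eq (@map_tuple_inj _)).
- by move=> m n x I J; exact: g_embed.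
- move=> m n m' n' a IHa d IHd I J; rewrite !ffunE /=.
  by rewrite !map_ltup !map_rtup IHa IHd.
- move=> m n p a IHa d IHd I J; rewrite !ffunE /=.
  rewrite (bigID (mem [set map_tuple e L | L : n.-tuple 'I_M])) /=.
  rewrite [X in (_ + X)%R]big1 ?addr0 => [|L LN].
    rewrite big_imset /=; last by move=> ? ? _ _; exact: map_tuple_inj.
    by apply: eq_big => [L|L _]; rewrite ?inE // IHa IHd.
  have [->|ne] := eqVneq (eval g a (map_tuple e I, L)) 0%R.
    by rewrite mul0r.
  have cL : all (pred1 b) (map col L).
    rewrite -(coloring_all C_pos b (coloring_eval ne)).
    exact: all_map_embed.
  have [L' eL] := map_tuple_embed cL.
  by case/imsetP: LN; exists L'.
Qed.

End Eval.

(** * The two colours of a quasi-direct sum *)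

Section Colors.
Variables (M N : nat).

Definition first_summand (k : 'I_(M + N)) : bool := k < M.

Lemma first_lshift k : first_summand (lshift N k) = true.
Proof. exact: (ltn_ord k). Qed.

Lemma first_rshift k : first_summand (@rshift M N k) = false.
Proof. by rewrite /first_summand /= ltnNge leq_addr. Qed.

Lemma first_lshiftP k : first_summand k = true -> exists l, k = lshift N l.
Proof.
rewrite -(splitK k); case: split => l /=; last by rewrite first_rshift.
by exists l.
Qed.

Lemma first_rshiftP k : first_summand k = false -> exists l, k = @rshift M N l.
Proof.
rewrite -(splitK k); case: split => l /=; first by rewrite first_lshift.
by exists l.
Qed.

Lemma lowP p (I : p.-tuple 'I_(M + N)) I' :
  low I = Some I' -> I = map_tuple (lshift N) I'.
Proof. by rewrite /low; case: pickP => // J /eqP <- [->]. Qed.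

Lemma highP p (I : p.-tuple 'I_(M + N)) I' :
  high I = Some I' -> I = map_tuple (@rshift M N) I'.
Proof. by rewrite /high; case: pickP => // J /eqP <- [->]. Qed.

Lemma map_first_lshift p (I : p.-tuple 'I_M) :
  map first_summand (map_tuple (lshift N) I) = nseq p true.
Proof.
apply: (@eq_from_nth _ true); first by rewrite !size_map size_tuple size_nseq.
rewrite !size_map size_tuple => i lti; rewrite nth_nseq lti.
rewrite -map_comp (nth_map (tnth I (Ordinal lti))) ?size_tuple //=.
exact: first_lshift.
Qed.

Lemma map_first_rshift p (I : p.-tuple 'I_N) :
  map first_summand (map_tuple (@rshift M N) I) = nseq p false.
Proof.
apply: (@eq_from_nth _ true); first by rewrite !size_map size_tuple size_nseq.
rewrite !size_map size_tuple => i lti; rewrite nth_nseq lti.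
rewrite -map_comp (nth_map (tnth I (Ordinal lti))) ?size_tuple //=.
exact: first_rshift.
Qed.

Variable K : comPzSemiRingType.

Lemma qdsum_low p q (A : hypermatrix K M p q) (B : hypermatrix K N p q) I J :
  qdsum A B (map_tuple (lshift N) I, map_tuple (lshift N) J) = A (I, J).
Proof. by rewrite ffunE /= !lowK. Qed.

(** Without outputs and inputs the empty index sequence is both low and
    high, and then the entry of the first summand is taken; hence the
    positivity hypothesis. *)
Lemma qdsum_high p q (A : hypermatrix K M p q) (B : hypermatrix K N p q) I J :
  0 < p ->
  qdsum A B (map_tuple (@rshift M N) I, map_tuple (@rshift M N) J) = B (I, J).
Proof.
move=> p_gt0; have ne : nseq p false <> nseq p true by case: (p) p_gt0.
rewrite ffunE /= !highK; case E: (low _) => [I'|] //; case: ne.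
have := congr1 (fun s : p.-tuple _ => map first_summand s) (lowP E).
by rewrite map_first_lshift map_first_rshift.
Qed.

Lemma qdsum_coloring p q (A : hypermatrix K M p q) (B : hypermatrix K N p q)
    (I : p.-tuple 'I_(M + N)) (J : q.-tuple 'I_(M + N)) :
  (qdsum A B (I, J) != 0)%R ->
  exists b, map first_summand I = nseq p b /\ map first_summand J = nseq q b.
Proof.
rewrite ffunE /=.
have hi : ((if (high I, high J) is (Some I', Some J') then B (I', J') else 0)
    != 0)%R ->
    exists b, map first_summand I = nseq p b /\ map first_summand J = nseq q b.
  case Ih: (high I) => [I'|]; case Jh: (high J) => [J'|]; rewrite ?eqxx // => _.
  by exists false; rewrite (highP Ih) (highP Jh) !map_first_rshift.
case Il: (low I) => [I'|]; case Jl: (low J) => [J'|] //.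
by exists true; rewrite (lowP Il) (lowP Jl) !map_first_lshift.
Qed.

End Colors.

Lemma mor_class (C : nat -> nat -> finType) (Q : PRO) (mu : pro_mor (Circ C) Q)
    m n (a : term C m n) :
  mu m n (class a) = eval (fun m n (x : C m n) => mu m n (chip x)) a.
Proof.
rewrite -(lift_class (fun m n (x : C m n) => mu m n (chip x))).
exact: lift_unique.
Qed.

Theorem theorem3 (K : GRing.ComPzSemiRing.type) (C : nat -> nat -> finType)
    (C_pos : forall m n : nat, C m n -> (0 < m)%N /\ (0 < n)%N)
    (N0 N1 : nat) (N0_gt0 : (0 < N0)%N) (N1_gt0 : (0 < N1)%N)
    (mu0 : multilinear_rep (Circ C) K N0) (mu1 : multilinear_rep (Circ C) K N1)
    (m n : nat) (c : Circ C m n) (c_connected : connected c) :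
  qdsum_rep mu0 mu1 m n c = qdsum (mu0 m n c) (mu1 m n c).
Proof.
move: c_connected; rewrite -[c]classK; move: (repr c) => {c} a a_conn.
rewrite !mor_class; apply/ffunP => -[I J].
set g := fun m n (x : C m n) => _.
have gE m' n' (x : C m' n') :
    g m' n' x = qdsum (mu0 m' n' (chip x)) (mu1 m' n' (chip x)).
  exact: lift_chip.
have g_col m' n' (x : C m' n') (I' : m'.-tuple 'I_(N0 + N1)) J' :
    (g m' n' x (I', J') != 0)%R -> exists b,
    map (@first_summand N0 N1) I' = nseq m' b /\
    map (@first_summand N0 N1) J' = nseq n' b.
  by rewrite gE; exact: qdsum_coloring.
have g_low m' n' (x : C m' n') I' J' :
    g m' n' x (map_tuple (lshift N1) I', map_tuple (lshift N1) J') =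
    mu0 m' n' (chip x) (I', J').
  by rewrite gE; exact: qdsum_low.
have g_high m' n' (x : C m' n') I' J' :
    g m' n' x (map_tuple (@rshift N0 N1) I', map_tuple (@rshift N0 N1) J') =
    mu1 m' n' (chip x) (I', J').
  by rewrite gE; apply: qdsum_high; case: (C_pos _ _ x).
have eval_low := eval_embed g_col C_pos (@lshift_inj N0 N1) (@first_lshift _ _)
  (@first_lshiftP _ _) g_low.
have eval_high := eval_embed g_col C_pos (@rshift_inj N0 N1) (@first_rshift _ _)
  (@first_rshiftP _ _) g_high.
rewrite [RHS]ffunE /=.
have off_diagonal : ~~ (low I && low J) -> ~~ (high I && high J) ->
    eval g a (I, J) = 0%R.
  move=> notlow nothigh; apply/eqP/negPn/negP => ne.
  have [[] [bI bJ]] := coloring_connected C_pos a_conn (coloring_eval g_col ne).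
    have [I' eI] := map_tuple_embed (@first_lshiftP _ _) bI.
    have [J' eJ] := map_tuple_embed (@first_lshiftP _ _) bJ.
    by rewrite eI eJ !lowK in notlow.
  have [I' eI] := map_tuple_embed (@first_rshiftP _ _) bI.
  have [J' eJ] := map_tuple_embed (@first_rshiftP _ _) bJ.
  by rewrite eI eJ !highK in nothigh.
have evalN_low : ~~ (low I && low J) -> eval g a (I, J) =
    if (high I, high J) is (Some I', Some J')
    then eval (fun m n (x : C m n) => mu1 m n (chip x)) a (I', J') else 0%R.
  case Ih: (high I) off_diagonal => [I'|] /=;
    case Jh: (high J) => [J'|] /= off_diagonal notlow; try exact: off_diagonal.
  by rewrite (highP Ih) (highP Jh) eval_high.
case Il: (low I) evalN_low => [I'|];
  case Jl: (low J) => [J'|] evalN_low; try exact: evalN_low.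
by rewrite (lowP Il) (lowP Jl) eval_low.
Qed.
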